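(* Let $b\in\mathbb{R}^n\setminus\mathbb{Z}^n$. For every finite subset $P\subseteq\mathbb{R}^n$, the following are all true: (a) the finite canonical face $C^P$ is a rational polyhedron in $\mathbb{R}^P$; (b) every extreme ray of $C^P$ is spanned by some $d\in\mathbb{Z}^P_+$ such that $\sum_{p\in P}p\,d(p)\in\mathbb{Z}^n$; (c) $\operatorname{rec}(C^P)=L\cap\mathbb{R}^{(\mathbb{R}^n)}_+\cap V_P=(L\cap V_P)\cap\mathbb{R}^P_+$ whenever $C^P\neq\emptyset$.
   Context: $\mathbb{R}^{(\mathbb{R}^n)}$ is the real vector space of functions $\mathbb{R}^n\to\mathbb{R}$ with finite support, $\mathbb{R}^{(\mathbb{R}^n)}_+$ the subset of its nonnegative functions. $I_b$ is the set of finite-support functions $y:\mathbb{R}^n\to\mathbb{Z}_+$ such that $\sum_{p\in\mathbb{R}^n}p\,y(p)\in b+\mathbb{Z}^n$. For $P\subseteq\mathbb{R}^n$, $V_P=\{y\in\mathbb{R}^{(\mathbb{R}^n)}:y(p)=0\ \forall p\notin P\}$, identified for finite $P$ with $\mathbb{R}^P$ by dropping the variables set to $0$, and $C^P=\operatorname{conv}(I_b)\cap V_P$ (conv is the convex hull). $L$ is the linear space parallel to $\operatorname{aff}(\operatorname{conv}(I_b))$, where $\operatorname{aff}$ denotes the set of affine combinations; equivalently, $L$ is the set of all $y\in\mathbb{R}^{(\mathbb{R}^n)}$ with $\sum_{p}\theta(p)y(p)=0$ for all additive $\theta:\mathbb{R}^n\to\mathbb{R}$ (i.e. $\theta(u+v)=\theta(u)+\theta(v)$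 for all $u,v$) vanishing on $\mathbb{Q}^n$. For a convex subset $C$ of a vector space $V$, $\operatorname{rec}(C)=\bigcap_{x\in C}\{r\in V:x+\lambda r\in C\ \forall\lambda\ge0\}$ (for $C=C^P$, the usual recession cone in $\mathbb{R}^P$). *)

(* Defs.v *)
From HB Require Import structures.
From mathcomp Require Import all_boot all_order all_algebra finmap.
From mathcomp Require Import boolp classical_sets reals.
From mathcomp Require Import monalg.

Set Implicit Arguments.
Unset Strict Implicit.
Unset Printing Implicit Defensive.

Import Order.TTheory GRing.Theory Num.Theory.

Local Open Scope ring_scope.
Local Open Scope classical_set_scope.

Section Convexity.
Context {R : numFieldType} {V : lmodType R}.
Implicit Types (S C E : set V) (d : V).

Definition aff S : set V :=
  [set v | exists (k : nat) (x : 'I_k -> V) (a : 'I_k -> R),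
    [/\ forall i, S (x i), \sum_i a i = 1 & v = \sum_i a i *: x i]].

Definition conv S : set V :=
  [set v | exists (k : nat) (x : 'I_k -> V) (a : 'I_k -> R),
    [/\ forall i, S (x i), forall i, 0 <= a i, \sum_i a i = 1
      & v = \sum_i a i *: x i]].

(* The linear space parallel to a nonempty affine space S. *)
Definition parallel_space S : set V := [set x - y | x in S & y in S].

(* With this formula, rec set0 is the whole space. *)
Definition rec C : set V :=
  [set r | forall x, C x -> forall l : R, 0 <= l -> C (x + l *: r)].

Definition half_line d : set V := [set l *: d | l in [set l : R | 0 <= l]].

Definition face C E : Prop :=
  [/\ E `<=` C, conv E `<=` E &
    forall (x y : V) (t : R), C x -> C y -> 0 < t < 1 ->
      E ((1 - t) *: x + t *: y) -> E x /\ E y].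

(* An extreme ray of C is a face of its recession cone that is a half-line. *)
Definition extreme_ray C E : Prop :=
  (exists2 r : V, r != 0 & E = half_line r) /\ face (rec C) E.

End Convexity.

(* {ffun I -> R^o} is R^I: the alias R^o of R is what makes it an lmodType. *)
Definition nonneg_orthant {R : numFieldType} {I : finType} :
    set {ffun I -> R^o} :=
  [set x | forall i, 0 <= x i :> R].

Definition rational_polyhedron {R : numFieldType} {I : finType}
    (C : set {ffun I -> R^o}) : Prop :=
  exists (m : nat) (A : 'I_m -> I -> rat) (c : 'I_m -> rat),
    C = [set x | forall k, \sum_(i : I) ratr (A k i) * x i <= ratr (c k) :> R].

Section InfiniteGroupRelaxation.
Context {R : realType} {n : nat}.
Implicit Types (b : 'rV[R]_n) (P : {fset 'rV[R]_n}).

(* Finitely supported functions 'rV[R]_n -> R as a vector space: the value of y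
   at p is y@_p and its support is msupp y. The multiplication that malg can
   carry plays no role here. *)
Definition fsupp_space : lmodType R := {malg R['rV[R]_n]}.

Definition fsupp_nonneg : set fsupp_space := [set y | forall p, 0 <= y@_p].

Definition I_ b : set fsupp_space :=
  [set y | (forall p, y@_p \is a Num.nat) /\
           \sum_(p <- msupp y) y@_p *: p - b \is a mxOver Num.int].

Definition V_ P : set fsupp_space := [set y | forall p, p \notin P -> y@_p = 0].

Definition L_ b : set fsupp_space := parallel_space (aff (conv (I_ b))).

Definition canonical_face b P : set fsupp_space := conv (I_ b) `&` V_ P.

(* The identification of V_ P with R^P. *)
Definition drop_zeros P (y : fsupp_space) : {ffun P -> R^o} :=
  [ffun p : P => y@_(val p)].

End InfiniteGroupRelaxation.

(* Main.v *)
Require Import Defs.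
From HB Require Import structures.
From mathcomp Require Import all_boot all_order all_algebra finmap.
From mathcomp Require Import boolp classical_sets reals.
From mathcomp Require Import monalg.
From mathcomp Require Import ring lra.

(* A convex combination of nonnegative functions that vanishes outside P only
   involves functions vanishing outside P, so C^P is the convex hull of
   S = {x in Z_+^P | sum_p x(p) p in b + Z^n}. Put
   M = {x in Z_+^P | sum_p x(p) p in Z^n}. By Dickson's lemma S = F + M with F
   finite and M is generated by a finite set H, hence
   conv S = conv F + cone H, which is a rational polyhedron (Weyl's theorem
   applied to the homogenization) with recession cone cone M when S is
   nonempty. An extreme ray of cone M is spanned by an element of M.
   Finally let r >= 0 in L vanish outside P, and write r = sum_j c_j y_j with
   y_j in I_b and sum_j c_j = 0. The c for which r has these properties form a
   cone defined by rational inequalities, so by Minkowski's theorem it has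
   rational generators; clearing denominators turns each of them into an
   element of M, whence r is in cone M. *)

Set Implicit Arguments.
Unset Strict Implicit.
Unset Printing Implicit Defensive.

Import Order.TTheory GRing.Theory Num.Theory.

Local Open Scope ring_scope.
Local Open Scope classical_set_scope.

(** * Linear combinations, cones and extreme rays *)

Section LinearCombinations.
Context {R : numFieldType}.

(** The total weight is an index and the admissible coefficients form a parameter [D], so that
    convex hulls ([nneg], weight 1), affine hulls ([setT], weight 1), cones ([nneg], any weight) and
    the space L ([setT], weight 0) all share one induction on the terms. *)
Inductive lcomb {V : lmodType R} (D : set R) (S : set V) : R -> V -> Prop :=
| lcomb0 : lcomb D S 0 0
| lcombS a s t v : D a -> S s -> lcomb D S t v ->
    lcomb D S (a + t) (a *: s + v).

Definition nneg : set R := [set a | 0 <= a].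

Definition cone {V : lmodType R} (S : set V) : set V :=
  [set v | exists t, lcomb nneg S t v].

Context {V : lmodType R}.
Implicit Types (D : set R) (S T : set V) (v w : V) (t u a : R).

Lemma lcombP D S t v :
  lcomb D S t v <->
  exists (k : nat) (x : 'I_k -> V) (a : 'I_k -> R),
    [/\ forall i, S (x i), forall i, D (a i), \sum_i a i = t
      & v = \sum_i a i *: x i].
Proof.
split.
  elim=> [|a s {}t {}v Da Ss _ []k [x [c [Sx Dc <- ->]]]].
    by exists 0%N, (fun=> 0), (fun=> 0); split; rewrite ?big_ord0 // => -[].
  exists k.+1, (oapp x s \o unlift ord0), (oapp c a \o unlift ord0).
  split=> [i|i||]; rewrite ?big_ord_recl /= ?unlift_none /=;
    try by case: (unliftP ord0 i) => [j|] _ /=; [exact: Sx || exact: Dc|].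
    by congr (_ + _); apply: eq_bigr => i _; rewrite liftK.
  by congr (_ + _); apply: eq_bigr => i _; rewrite liftK.
move=> [k [x [a [Sx Da <- ->]]]].
elim: k x a Sx Da => [|k IH] x a Sx Da; first by rewrite !big_ord0; constructor.
by rewrite !big_ord_recl; constructor=> //; apply: IH.
Qed.

Lemma conv_lcomb S : conv S = lcomb nneg S 1.
Proof. by apply/seteqP; split=> v; rewrite lcombP. Qed.

Lemma aff_lcomb S : aff S = lcomb setT S 1.
Proof.
apply/seteqP; split=> v; rewrite lcombP.
  by move=> [k [x [a [? ? ?]]]]; exists k, x, a.
by move=> [k [x [a []*]]]; exists k, x, a.
Qed.

Lemma lcomb_mem D S a s : D a -> S s -> lcomb D S a (a *: s).
Proof.
by move=> Da Ss; have := lcombS Da Ss (lcomb0 D S); rewrite !addr0.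
Qed.

Lemma lcombD D S t u v w :
  lcomb D S t v -> lcomb D S u w -> lcomb D S (t + u) (v + w).
Proof.
move=> Sv Sw; elim: Sv => [|a s {}t {}v Da Ss _ IH]; first by rewrite !add0r.
by rewrite -!addrA; constructor.
Qed.

Lemma lcombZ D S t v c : (forall a, D a -> D (c * a)) ->
  lcomb D S t v -> lcomb D S (c * t) (c *: v).
Proof.
move=> Dc; elim=> [|a s {}t {}v Da Ss _ IH]; first by rewrite mulr0 scaler0;
  constructor.
by rewrite mulrDr scalerDr scalerA; constructor=> //; apply: Dc.
Qed.

Lemma lcomb_sub D D' S T t v : D `<=` D' -> S `<=` T ->
  lcomb D S t v -> lcomb D' T t v.
Proof.
by move=> DD ST; elim=> *; constructor=> //; [apply: DD|apply: ST].
Qed.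

Lemma lcomb_lcomb D S t v : (forall a c, D a -> D c -> D (a * c)) ->
  lcomb D (lcomb D S 1) t v -> lcomb D S t v.
Proof.
move=> DM; elim=> [|a s {}t {}v Da Ss _ IH]; first by constructor.
apply: lcombD => //; rewrite -[X in lcomb _ _ X _]mulr1.
by apply: lcombZ => // c; apply: DM.
Qed.

Lemma lcomb_translate D S T t v w : (forall s, S s -> T (s + w)) ->
  lcomb D S t v -> lcomb D T t (v + t *: w).
Proof.
move=> ST; elim=> [|a s {}t {}v Da Ss _ IH].
  by rewrite scale0r addr0; constructor.
have -> : a *: s + v + (a + t) *: w = a *: (s + w) + (v + t *: w).
  by rewrite scalerDr scalerDl addrACA.
by constructor=> //; apply: ST.
Qed.

Lemma lcomb_nneg_ge0 S t v : lcomb nneg S t v -> 0 <= t.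
Proof. by elim=> // a s {}t {}v a0 _ _; apply: addr_ge0. Qed.

Lemma lcomb_nneg0 S v : lcomb nneg S 0 v -> v = 0.
Proof.
move: {1 3}0 (erefl (0 : R)) => t /[swap];
  elim=> // a s {}t {}v a0 _ Sv IH /eqP.
rewrite paddr_eq0 ?(lcomb_nneg_ge0 Sv) // => /andP[/eqP -> /eqP t0].
by rewrite IH // scale0r addr0.
Qed.

Lemma cone0 S : cone S 0.
Proof. by exists 0; constructor. Qed.

Lemma coneZ_mem S a s : 0 <= a -> S s -> cone S (a *: s).
Proof. by move=> a0 Ss; exists a; apply: lcomb_mem. Qed.

Lemma cone_mem S s : S s -> cone S s.
Proof. by rewrite -{2}[s]scale1r => ?; apply: coneZ_mem. Qed.

Lemma coneD S v w : cone S v -> cone S w -> cone S (v + w).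
Proof. by move=> [t ?] [u ?]; exists (t + u); apply: lcombD. Qed.

Lemma coneZ S a v : 0 <= a -> cone S v -> cone S (a *: v).
Proof.
move=> a0 [t ?]; exists (a * t); apply: lcombZ => // c c0; exact: mulr_ge0.
Qed.

Lemma cone_ind S (Q : V -> Prop) : Q 0 ->
  (forall a s v, 0 <= a -> S s -> cone S v -> Q v -> Q (a *: s + v)) ->
  cone S `<=` Q.
Proof.
move=> Q0 Qs v [t]; elim=> // a s {}t {}v a0 Ss Sv; apply: Qs => //.
by exists t.
Qed.

(** Discarding the vanishing leading terms of a combination leaves one that starts with a positive
    multiple of a nonzero generator. That generator is the candidate for spanning an extreme ray. *)
Lemma cone_neq0 S v : cone S v -> v != 0 ->
  exists a s w, [/\ 0 < a, S s, s != 0, cone S w & v = a *: s + w].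
Proof.
move: v; apply: cone_ind => [/eqP //|a s v]; rewrite le0r.
case/orP=> [/eqP -> _ _ IH|a0 Ss Sv IH]; first by rewrite scale0r add0r.
have [-> |s0 _] := eqVneq s 0; last by exists a, s, v.
rewrite scaler0 add0r => /IH [c [x [w [? ? ? ? ->]]]].
by exists c, x, w.
Qed.

Lemma half_lineZ a v : 0 < a -> half_line (a *: v) = half_line v.
Proof.
move=> a0; apply/seteqP; split=> _ [l l0 <-].
  by exists (l * a); rewrite ?scalerA //=; apply: mulr_ge0 => //; apply: ltW.
exists (l / a); first by apply: divr_ge0 => //; apply: ltW.
by rewrite scalerA divfK // gt_eqF.
Qed.

(* rec set0 is the whole space, which has no half-line as a face. *)
Lemma extreme_ray_nonempty S E : extreme_ray S E -> S !=set0.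
Proof.
move=> [[r r0 ->] [_ _ fE]]; apply: contrapT => S0.
have recT x : rec S x by move=> y Sy; case: S0; exists y.
(* The midpoint of [- r] and [r] is 0, which lies on the half-line; the face property would then put
   [- r] there as well. *)
have : half_line r ((1 - 2^-1) *: - r + 2^-1 *: r).
  exists 0 => //=; rewrite scale0r scalerN -scaleNr -scalerDl opprB.
  have -> : (2^-1 - 1 + 2^-1 : R) = 0 by field.
  by rewrite scale0r.
case/fE => //; first by apply/andP; split;
  [rewrite invr_gt0 | rewrite invf_lt1 // ltr1n].
case=> l /= l0 /eqP; rewrite -subr_eq0 opprK -[X in _ + X]scale1r -scalerDl.
by rewrite scaler_eq0 (negPf r0) orbF gt_eqF // ltr_wpDl.
Qed.

(** If the ray is spanned by [r = a *: s + w] with [a > 0] and [s] a nonzero generator, then [r] is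
    the midpoint of [2 *: w] and [(2 * a) *: s]. Both lie in the cone, so the face property puts the
    second on the ray, and [s] spans it. *)
Lemma extreme_ray_cone S T E : rec S = cone T -> extreme_ray S E ->
  exists2 s, T s & E = half_line s.
Proof.
move=> recS [[r r0 ->] [Esub _ fE]].
have Er : half_line r r by exists 1; rewrite ?scale1r //= ler01.
have := Esub r Er; rewrite recS => /cone_neq0 /(_ r0).
move=> [a [s [w [a0 Ts s0 Tw rE]]]].
have [] := fE (2 *: w) ((2 * a) *: s) 2^-1.
- by rewrite recS; apply: coneZ.
- by rewrite recS; apply: coneZ_mem => //; rewrite mulr_ge0 // ltW.
- by apply/andP; split; [rewrite invr_gt0 | rewrite invf_lt1 // ltr1n].
- rewrite !scalerA.
  have -> : (2^-1 * (2 * a) : R) = a by field.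
  have -> : ((1 - 2^-1) * 2 : R) = 1 by field.
  by rewrite scale1r addrC -rE.
move=> _ [l /= l0 lr]; exists s => //.
have l1 : 0 < l.
  rewrite lt_neqAle l0 andbT eq_sym;
    apply: contra_not_neq (elimN eqP s0) => l00.
  move/eqP: lr; rewrite l00 scale0r eq_sym scaler_eq0 mulf_eq0.
  by rewrite pnatr_eq0 (gt_eqF a0) /= => /eqP.
by rewrite -(half_lineZ r l1) lr half_lineZ // mulr_gt0.
Qed.

End LinearCombinations.

Lemma lcomb_morph {R : numFieldType} {V W : lmodType R} (f : V -> W)
    (D : set R) (S : set V) (T : set W) t v :
  f 0 = 0 -> (forall a u w, f (a *: u + w) = a *: f u + f w) ->
  (forall s, S s -> T (f s)) -> lcomb D S t v -> lcomb D T t (f v).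
Proof.
move=> f0 fL ST; elim=> [|a s {}t {}v Da Ss _ IH].
  by rewrite f0; constructor.
by rewrite fL; constructor=> //; apply: ST.
Qed.

(** * Polyhedral cones *)

Section PolyhedralCones.
Context {R : realFieldType} {I : finType}.
Implicit Types (x y : {ffun I -> R^o}) (A B g : {ffun I -> rat}).

Definition dot x y : R := \sum_i x i * y i.

(** Constraints and generators are stored as rational vectors and only evaluated over [R], so the
    descriptions obtained below are rational by construction. *)
Definition real_vec (A : {ffun I -> rat}) : {ffun I -> R^o} :=
  [ffun i => ratr (A i)].

Definition real_vecs (As : seq {ffun I -> rat}) : set {ffun I -> R^o} :=
  [set real_vec A | A in [set` As]].

Definition halfspaces (As : seq {ffun I -> rat}) : set {ffun I -> R^o} :=
  [set x | forall A, A \in As -> dot (real_vec A) x <= 0].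

Lemma dotC x y : dot x y = dot y x.
Proof. by apply: eq_bigr => i _; rewrite mulrC. Qed.

Lemma dotDr x y z : dot x (y + z) = dot x y + dot x z.
Proof. by rewrite -big_split; apply: eq_bigr => i _; rewrite ffunE mulrDr. Qed.

Lemma dotZr a x y : dot x (a *: y) = a * dot x y.
Proof. by rewrite mulr_sumr; apply: eq_bigr => i _; rewrite ffunE mulrCA. Qed.

Lemma dot0r x : dot x 0 = 0.
Proof. by rewrite [LHS]big1 // => i _; rewrite ffunE mulr0. Qed.

Lemma dotBr x y z : dot x (y - z) = dot x y - dot x z.
Proof. by rewrite dotDr -scaleN1r dotZr mulN1r. Qed.

Lemma cone_halfspaces (S : set {ffun I -> R^o}) As :
  S `<=` halfspaces As -> cone S `<=` halfspaces As.
Proof.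
move=> SA x Sx A AAs; move: x Sx; apply: cone_ind => [|a s v a0 Ss _ IH].
  by rewrite dot0r.
by rewrite dotDr dotZr ler_wnDr // mulr_ge0_le0 //; apply: SA.
Qed.

Lemma cone_dot_le0 (S : set {ffun I -> R^o}) x y :
  cone S x -> (forall s, S s -> dot s y <= 0) -> dot x y <= 0.
Proof.
move=> Sx Sy; move: x Sx; apply: cone_ind => [|a s v a0 Ss _ IH].
  by rewrite dotC dot0r.
rewrite dotC dotDr dotZr ![dot y _]dotC ler_wnDr //.
by rewrite mulr_ge0_le0 //; apply: Sy.
Qed.

(** This selects the eliminated variable in Fourier-Motzkin elimination, between its lower bounds
    [s1] and its upper bounds [s2]; either list may be empty. *)
Lemma between_seqs (s1 s2 : seq R) :
  (forall u v, u \in s1 -> v \in s2 -> u <= v) ->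
  exists t, (forall u, u \in s1 -> u <= t) /\ (forall v, v \in s2 -> t <= v).
Proof.
elim: s1 => [|u s1 IH] s12.
  elim: s2 {s12} => [|v s2 [t [_ tP]]]; first by exists 0.
  exists (Num.min v t); split=> // w; rewrite inE ge_min => /predU1P[->|/tP ->].
    by rewrite lexx.
  by rewrite orbT.
have [|t [t1 t2]] := IH; first by move=> w v ws vs; apply: s12;
  rewrite ?inE ?ws ?orbT.
exists (Num.max u t); split=> [w|v vs].
  by rewrite inE le_max => /predU1P[->|/t1 ->]; rewrite ?lexx ?orbT.
by rewrite ge_max t2 // s12 // inE eqxx.
Qed.

(* The projection step of Fourier-Motzkin elimination: a constraint of A with
   dot A g < 0 bounds t from above in [x - t g], one with dot A g > 0 bounds it
   from below, and t exists iff these bounds are pairwise compatible. *)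
Lemma halfspaces_add_ray As g : exists Bs, forall x,
  halfspaces Bs x <-> exists2 t, 0 <= t & halfspaces As (x - t *: real_vec g).
Proof.
pose al A : rat := \sum_i A i * g i.
have dotAg A : dot (real_vec A) (real_vec g) = ratr (al A) :> R.
  by rewrite /dot /al rmorph_sum; apply: eq_bigr => i _; rewrite !ffunE rmorphM.
pose N := [seq A <- As | al A <= 0]; pose P := [seq A <- As | 0 < al A].
pose comb A B : {ffun I -> rat} := [ffun i => al A * B i - al B * A i].
have dot_comb A B x : dot (real_vec (comb A B)) x =
    ratr (al A) * dot (real_vec B) x - ratr (al B) * dot (real_vec A) x.
  rewrite /dot !mulr_sumr -sumrB; apply: eq_bigr => i _.
  by rewrite !ffunE rmorphB !rmorphM mulrBl !mulrA.
(* The vector [comb A B] is orthogonal to [g], so it pairs the bounds on t given by [A] and [B]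
   without mentioning t. The constraints in [N] are kept as they are: they pair the upper bounds
   with the lower bound 0, and include those independent of t. *)
exists (N ++ [seq comb A B | A <- P, B <- N]) => x; split.
  move=> xB.
  pose bound A := dot (real_vec A) x / ratr (al A) : R.
  pose N' := [seq A <- As | al A < 0].
  have [|t [tl tu]] := @between_seqs (0 :: map bound P) (map bound N').
    move=> u v; rewrite inE => /predU1P[->|/mapP[A AP ->]] /mapP[B + ->].
      rewrite mem_filter => /andP[B0 BAs].
      rewrite /bound mulr_le0 //; last by rewrite invr_le0 lerq0 ltW.
      by apply: xB; rewrite mem_cat mem_filter BAs ltW.
    rewrite mem_filter => /andP[B0 BAs].
    have A0 : 0 < al A by move: AP; rewrite mem_filter => /andP[].
    have : dot (real_vec (comb A B)) x <= 0.
      apply: xB; rewrite mem_cat; apply/orP; right; apply/allpairsP;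
        exists (A, B).
      by rewrite /= AP mem_filter BAs ltW.
    rewrite dot_comb subr_le0 /bound => H.
    rewrite ler_pdivrMr ?ltr0q // mulrAC ler_ndivlMr ?ltrq0 //.
    by rewrite mulrC (mulrC _ (ratr (al B))).
  exists t; first by apply: tl; rewrite inE eqxx.
  move=> A AAs; rewrite dotBr dotZr dotAg subr_le0.
  have [A0|A0|A0] := ltgtP (al A) 0.
  - by rewrite -ler_ndivlMr ?ltrq0 // -/(bound A); apply: tu; apply: map_f;
    rewrite mem_filter A0.
  - rewrite -ler_pdivrMr ?ltr0q // -/(bound A); apply: tl;
    rewrite inE map_f ?orbT //.
    by rewrite mem_filter A0.
  - by rewrite A0 rmorph0 mulr0; apply: xB;
    rewrite mem_cat mem_filter A0 lexx AAs.
move=> [t t0 xt] B; have xA A : A \in As -> dot (real_vec A) x <= t * ratr (al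
  A).
  by move=> /xt; rewrite dotBr dotZr dotAg subr_le0.
rewrite mem_cat mem_filter => /orP[/andP[B0 /xA /le_trans]|].
  by apply; rewrite mulr_ge0_le0 // lerq0.
move=> /allpairsP[[A C] [/= + + ->]];
  rewrite !mem_filter => /andP[A0 AAs] /andP[C0 CAs].
rewrite dot_comb subr_le0;
  apply: (@le_trans _ _ (t * ratr (al A) * ratr (al C))).
  by rewrite [leRHS]mulrAC [leRHS]mulrC; apply: ler_wpM2l;
    [rewrite ler0q ltW|apply: xA].
by rewrite [leLHS]mulrC; apply: ler_wnM2l; [rewrite lerq0|apply: xA].
Qed.

(** Induction on the generators: the cone {0} is cut out by the inequalities x_i <= 0 and -x_i <= 0,
    and each further generator is handled by [halfspaces_add_ray]. *)
Theorem weyl (gs : seq {ffun I -> rat}) :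
  exists As, cone (real_vecs gs) = halfspaces As.
Proof.
suff [As AsP] : exists As, forall x, cone (real_vecs gs) x <-> halfspaces As x.
  by exists As; apply/seteqP; split=> x /AsP.
elim: gs => [|g gs [As IH]].
  exists ([seq [ffun j => (j == i)%:R] | i <- enum I] ++
          [seq [ffun j => - (j == i)%:R] | i <- enum I]) => x; split.
    by move: x; apply: cone_halfspaces => ? [].
  move=> xA; suff -> : x = 0 by exact: cone0.
  have delta (i : I) (c : rat) : dot (real_vec [ffun j => c * (j == i)%:R]) x =
    ratr c * x i.
    rewrite /dot (bigD1 i) //= big1 => [|j /negPf ji]; rewrite !ffunE ?ji.
      by rewrite eqxx mulr1 addr0.
    by rewrite mulr0 rmorph0 mul0r.
  apply/ffunP => i; rewrite ffunE; apply/eqP; rewrite eq_le; apply/andP; split.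
    have := delta i 1; rewrite rmorph1 mul1r => <-.
    apply: xA; rewrite mem_cat; apply/orP; left; apply/mapP; exists i;
      rewrite ?mem_enum //.
    by apply/ffunP => j; rewrite !ffunE mul1r.
  have := delta i (-1); rewrite rmorphN1 mulN1r -oppr_le0 => <-.
  apply: xA; rewrite mem_cat; apply/orP; right; apply/mapP; exists i;
    rewrite ?mem_enum //.
  by apply/ffunP => j; rewrite !ffunE mulN1r.
have [Bs BsP] := halfspaces_add_ray As g; exists Bs => x; rewrite BsP; split.
  move: x; apply: cone_ind => [|a s v a0 [h /= + <-] Sv [t t0 /IH vt]].
    by exists 0 => //; rewrite scale0r subr0; apply/IH; exact: cone0.
  rewrite inE => /predU1P[->|hgs].
    exists (a + t); first exact: addr_ge0.
    by apply/IH; rewrite scalerDl opprD addrACA subrr add0r.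
  exists t => //; apply/IH; rewrite -addrA; apply: coneD => //.
  by apply: coneZ_mem => //; exists h.
move=> [t t0 /IH xt]; rewrite -[x](subrK (t *: real_vec g)); apply: coneD.
  move: xt => [u xt]; exists u; apply: lcomb_sub xt => // _ [h /= hgs <-].
  by exists h => //=; rewrite inE hgs orbT.
by apply: coneZ_mem => //; exists g; rewrite //= inE eqxx.
Qed.

(* Bs is the dual description of cone As; a constraint D of cone Bs is
   nonpositive on Bs, that is, D lies in cone As. *)
Theorem minkowski (As : seq {ffun I -> rat}) :
  exists Bs, halfspaces As = cone (real_vecs Bs).
Proof.
have [Bs BsP] := weyl As; have [Ds DsP] := weyl Bs.
exists Bs; apply/seteqP; split=> x.
  move=> xA; rewrite DsP => D DDs.
  have : cone (real_vecs As) (real_vec D).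
    rewrite BsP => B BBs; rewrite dotC.
    suff : halfspaces Ds (real_vec B) by apply.
    by rewrite -DsP; apply: cone_mem; exists B.
  by move/cone_dot_le0; apply => _ [A /= AAs <-]; apply: xA.
move: x; apply: cone_halfspaces => _ [B /= BBs <-] A AAs; rewrite dotC.
suff : halfspaces Bs (real_vec A) by apply.
by rewrite -BsP; apply: cone_mem; exists A.
Qed.

End PolyhedralCones.

(** * Dickson's lemma *)

Section Dickson.
Context {I : finType}.
Implicit Types (S M : set {ffun I -> nat}) (x y z : {ffun I -> nat}).

(** Induction on the coordinates taken into account. Let [F] work for [s], and let [T] be the
    largest value at [i] in [F]. A point with [x i >= T] is dominated by [F] also at [i]; the others
    lie in the finitely many slices [x i = t] with [t < T], each of which has its own finite set by
    induction. *)
Lemma dickson_on (s : seq I) S : exists2 F : seq {ffun I -> nat},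
  [set` F] `<=` S &
  forall x, S x -> exists2 f, f \in F & forall i, i \in s -> (f i <= x i)%N.
Proof.
elim: s S => [|i s IH] S.
  have [S0|] := pselect (S !=set0).
    by have [f Sf] := S0; exists [:: f] => [g|x _]; [|exists f; rewrite ?inE];
      rewrite /= ?inE // => /eqP ->.
  by move=> S0; exists [::] => // x Sx; case: S0; exists x.
have [F FS FP] := IH S.
have /choice[G GP] t : exists G : seq {ffun I -> nat},
    [set` G] `<=` S `&` [set x | x i = t] /\
    forall x, (S `&` [set x | x i = t]) x ->
      exists2 f, f \in G & forall j, j \in s -> (f j <= x j)%N.
  by have [G] := IH (S `&` [set x | x i = t]); exists G.
pose T := \max_(f <- F) f i.
exists (F ++ flatten [seq G t | t <- iota 0 T]) => [f /=|x Sx].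
  rewrite mem_cat => /orP[/FS //|/flatten_mapP[t _ fG]].
  by have [/(_ f fG)[]] := GP t.
have [Tx|xT] := leqP T (x i).
  have [f fF fx] := FP x Sx; exists f; first by rewrite mem_cat fF.
  move=> j; rewrite inE => /predU1P[->|/fx //]; apply: leq_trans Tx.
  exact: leq_bigmax_seq.
have [GS GxP] := GP (x i); have [|f fG fx] := GxP x; first by split.
exists f; first by rewrite mem_cat; apply/orP; right; apply/flatten_mapP;
  exists (x i); rewrite ?mem_iota.
move=> j; rewrite inE => /predU1P[->|/fx //].
by have [_ /= ->] := GS f fG.
Qed.

Lemma dickson S : exists2 F : seq {ffun I -> nat},
  [set` F] `<=` S & forall x, S x -> exists2 f, f \in F & exists z, x = f + z.
Proof.
have [F FS FP] := dickson_on (enum I) S; exists F => // x Sx.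
have [f fF fx] := FP x Sx; exists f => //; exists [ffun i => (x i - f i)%N].
by apply/ffunP => i; rewrite !ffunE; apply/esym/subnKC/fx; rewrite mem_enum.
Qed.

End Dickson.

(** * Integer hulls *)

Section IntegerHull.
Context {R : realType} {I : finType}.
Implicit Types (x y z : {ffun I -> nat}) (v w r : {ffun I -> R^o}) (a : R).

Definition nat_vec (F : numFieldType) (x : {ffun I -> nat}) : {ffun I -> F^o} :=
  [ffun i => (x i)%:R].

Lemma nat_vecD (F : numFieldType) x z :
  nat_vec F (x + z) = nat_vec F x + nat_vec F z.
Proof. by apply/ffunP => i; rewrite !ffunE natrD. Qed.

Lemma nat_vecMn (F : numFieldType) x k : nat_vec F (x *+ k) = k%:R *: nat_vec F
  x.
Proof.
elim: k => [|k IH]; first by apply/ffunP => i; rewrite scale0r !ffunE.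
by rewrite mulrSr nat_vecD IH -natr1 scalerDl scale1r.
Qed.

Definition nat_vecs (S : set {ffun I -> nat}) : set {ffun I -> R^o} :=
  [set nat_vec R x | x in S].

(** The extra coordinate [None] is the height, which turns affine inequalities in [v] into linear
    ones. *)
Definition homog (F : numFieldType) (v : {ffun I -> F^o}) (t : F) :
    {ffun option I -> F^o} :=
  [ffun o => if o is Some i then v i else t].

Lemma homogD (F : numFieldType) (v w : {ffun I -> F^o}) (t u : F) :
  homog (v + w) (t + u) = homog v t + homog w u.
Proof. by apply/ffunP => -[i|]; rewrite !ffunE. Qed.

Lemma homogZ (F : numFieldType) (v : {ffun I -> F^o}) (a t : F) :
  homog (a *: v) (a * t) = a *: homog v t.
Proof. by apply/ffunP => -[i|]; rewrite !ffunE. Qed.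

Lemma homog0 (F : numFieldType) : homog (0 : {ffun I -> F^o}) 0 = 0.
Proof. by apply/ffunP => -[i|]; rewrite !ffunE. Qed.

Lemma homog_nat_vec x (e : nat) :
  real_vec (homog (nat_vec rat x) e%:R) = homog (nat_vec R x) e%:R.
Proof. by apply/ffunP => -[i|]; rewrite !ffunE /= ratr_nat. Qed.

(* S and M behave like the points of N^I in a coset of a subgroup, resp. in the
   subgroup itself. *)
Context (S M : set {ffun I -> nat}).
Hypothesis SDM : forall x z, S x -> M z -> S (x + z).
Hypothesis SDK : forall x z, S x -> S (x + z) -> M z.
Hypothesis MDK : forall x z, M x -> M (x + z) -> M z.

Lemma coset_fingen : exists2 F : seq {ffun I -> nat}, [set` F] `<=` S &
  forall x, S x -> exists2 f, f \in F & exists2 z, M z & x = f + z.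
Proof.
have [F FS FP] := dickson S; exists F => // x Sx.
have [f fF [z xE]] := FP x Sx; exists f => //; exists z => //.
by apply: (SDK (FS f fF)); rewrite -xE.
Qed.

(** Dickson's lemma is applied to the nonzero elements of [M]: subtracting a nonzero [h] from [x]
    stays in [M] by cancellation and lowers the coordinate sum, on which the induction runs. *)
Lemma monoid_fingen : exists2 H : seq {ffun I -> nat}, [set` H] `<=` M &
  forall x, M x -> cone [set nat_vec R h | h in [set` H]] (nat_vec R x).
Proof.
have [H HM HP] := dickson (M `&` [set x | x != 0]).
exists H => [h /HM[]//|x].
have [n] := ubnP (\sum_i x i)%N; elim: n x => // n IH x xn Mx.
have [->|x0] := eqVneq x 0.
  have -> : nat_vec R 0 = 0 by apply/ffunP => i; rewrite !ffunE.
  exact: cone0.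
have [h hH [z xE]] := HP x (conj Mx x0); have [Mh h0] := HM h hH.
rewrite xE nat_vecD; apply: coneD; first by apply: cone_mem; exists h.
apply: IH; last by apply: (MDK Mh); rewrite -xE.
rewrite -ltnS; apply: leq_trans xn; rewrite ltnS xE.
have -> : (\sum_i (h + z)%R i = \sum_i h i + \sum_i z i)%N.
  by rewrite -big_split; apply: eq_bigr => i _; rewrite ffunE.
rewrite -[ltnLHS]add0n ltn_add2r lt0n.
apply: contraNneq h0 => /eqP; rewrite sum_nat_eq0 => /forallP hz.
by apply/eqP/ffunP => i; rewrite ffunE; apply/eqP/hz.
Qed.

(** Its slice at height 1 is conv S + cone M and its slice at height 0 is cone M, so a single system
    of inequalities describes both the hull and its recession cone. *)
Definition homog_cone v (t : R) : Prop :=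
  exists w r, [/\ v = w + r, lcomb nneg (nat_vecs S) t w & cone (nat_vecs M) r].

(** Since each s in [S] splits as f + m, we have (s, 1) = (f, 1) + (m, 0), and the cone is generated
    by the finitely many (f, 1) and (h, 0) with f in [F] and h in [H]. Weyl's theorem then
    applies. *)
Lemma homog_cone_polyhedral : exists As : seq {ffun option I -> rat},
  forall v t, homog_cone v t <-> halfspaces As (homog v t).
Proof.
have [F FS FP] := coset_fingen; have [H HM HP] := monoid_fingen.
pose gs := [seq homog (nat_vec rat f) 1%:R | f <- F] ++
           [seq homog (nat_vec rat h) 0%:R | h <- H].
have [As AsP] := @weyl R _ gs; exists As => v t; rewrite -AsP.
have homM r : cone (nat_vecs M) r -> cone (real_vecs gs) (homog r 0).
  have homH w : cone [set nat_vec R h | h in [set` H]] w ->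
      cone (real_vecs gs) (homog w 0).
    move: w; apply: cone_ind => [|a _ w a0 [h /= hH <-] _ IH].
      by rewrite homog0; exact: cone0.
    rewrite -[0](addr0) -{1}(mulr0 a) homogD homogZ; apply: coneD => //.
    apply: coneZ_mem => //; exists (homog (nat_vec rat h) 0%:R).
      by rewrite /= mem_cat (map_f (fun h => homog (nat_vec rat h) 0%:R)) ?orbT.
    exact: homog_nat_vec.
  move: r; apply: cone_ind => [|a _ w a0 [m /HP/homH Mm <-] _ IH].
    by rewrite homog0; exact: cone0.
  rewrite -[0](addr0) -{1}(mulr0 a) homogD homogZ; apply: coneD => //.
  exact: coneZ.
split.
  move=> [w [r [-> Sw /homM Mr]]]; rewrite -[t]addr0 homogD; apply: coneD => //.
  elim: Sw => [|a _ {}t {}w a0 [s Ss <-] _ IH]; first by rewrite homog0;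
    exact: cone0.
  rewrite -[a in a + t]mulr1 homogD homogZ; apply: coneD => //;
    apply: coneZ => //.
  have [f fF [m Mm ->]] := FP s Ss.
  rewrite nat_vecD -[1]addr0 homogD; apply: coneD; last first.
    by apply: homM; apply: cone_mem; exists m.
  apply: cone_mem; exists (homog (nat_vec rat f) 1%:R).
    by rewrite /= mem_cat (map_f (fun h => homog (nat_vec rat h) 1%:R)).
  exact: homog_nat_vec.
suff gen : forall u : {ffun option I -> R^o}, cone (real_vecs gs) u ->
    homog_cone [ffun i => u (Some i)] (u None).
  move/gen; rewrite ffunE; suff -> : [ffun i => homog v t (Some i)] = v by [].
  by apply/ffunP => i; rewrite !ffunE.
apply: cone_ind => [|a _ u a0 [g /= + <-] _ [w [r [uE Sw Mr]]]].
  exists 0, 0; split; first by apply/ffunP => i; rewrite !ffunE addr0.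
    by rewrite ffunE; constructor.
  exact: cone0.
rewrite mem_cat => /orP[/mapP[f fF ->]|/mapP[h hH ->]]; rewrite homog_nat_vec.
  exists (a *: nat_vec R f + w), r; split => //.
    by rewrite -addrA -uE; apply/ffunP => i; rewrite !ffunE.
  rewrite !ffunE /= (mulr1 a : a *: (1%:R : R^o) = a); constructor => //;
    exists f => //; exact: FS.
exists w, (a *: nat_vec R h + r); split.
- by rewrite addrCA -uE; apply/ffunP => i; rewrite !ffunE.
- by rewrite !ffunE /= (mulr0 a : a *: (0%:R : R^o) = 0) add0r.
- by apply: coneD => //; apply: coneZ_mem => //; exists h => //; exact: HM.
Qed.

(** A real multiple a m need not be integral, but for an integer N > a the point v + a m is the
    convex combination (1 - a/N) v + (a/N) (v + N m), and v + N m lies in the hull because [S] is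
    stable under adding m. *)
Lemma conv_absorb v r :
  conv (nat_vecs S) v -> cone (nat_vecs M) r -> conv (nat_vecs S) (v + r).
Proof.
rewrite conv_lcomb => + Mr; move: r Mr v; apply: cone_ind => [v|];
  first by rewrite addr0.
move=> a _ r a0 [m Mm <-] _ IH v Sv; rewrite addrA; apply: IH.
have SMn x k : S x -> S (x + m *+ k).
  by elim: k => [|k IHk] Sx; rewrite ?addr0 // mulrSr addrA; apply: SDM => //;
    apply: IHk.
pose N := (Num.truncn a).+1; have aN : a < N%:R by exact: truncnS_gt.
have N0 : (0 : R) < N%:R by rewrite ltr0n.
have SvN : lcomb nneg (nat_vecs S) 1 (v + 1 *: (N%:R *: nat_vec R m)).
  apply: lcomb_translate Sv => _ [x Sx <-]; exists (x + m *+ N);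
    first exact: SMn.
  by rewrite nat_vecD nat_vecMn.
have aN1 : a / N%:R <= 1 by rewrite ler_pdivrMr // mul1r ltW.
have {SvN} := lcombD (lcombZ (c := 1 - a / N%:R) _ Sv) (lcombZ (c := a / N%:R)
  _ SvN).
rewrite !mulr1 subrK scale1r scalerDr scalerA divfK ?gt_eqF // addrA -scalerDl
  subrK scale1r.
by apply=> c c0; apply: mulr_ge0 => //;
  [rewrite subr_ge0|apply: divr_ge0 => //; apply: ltW].
Qed.

Lemma conv_homog_cone v : conv (nat_vecs S) v <-> homog_cone v 1.
Proof.
split=> [Sv|[w [r [-> Sw Mr]]]]; last by apply: conv_absorb;
  rewrite ?conv_lcomb.
by exists v, 0; split; rewrite ?addr0 -?conv_lcomb //; exact: cone0.
Qed.

Theorem integer_hull_polyhedral : rational_polyhedron (conv (nat_vecs S)).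
Proof.
have [As AsP] := homog_cone_polyhedral.
(* At height 1 the coefficient of [None] becomes a constant term, which moves to the right-hand
   side. *)
exists (size As), (fun k i => nth 0 As k (Some i)), (fun k => - nth 0 As k
  None).
have dot_homog A v : dot (real_vec A) (homog v 1) =
    \sum_(i : I) ratr (A (Some i)) * v i + ratr (A None) :> R.
  rewrite /dot (bigD1 None) //= !ffunE mulr1 addrC; congr (_ + _).
  rewrite (reindex_omap Some id) //=; last by case.
  by apply: eq_big => [i|i _]; rewrite ?eqxx // !ffunE.
apply/seteqP; split=> v.
  move/conv_homog_cone/AsP => vA k /=; rewrite rmorphN.
  have := vA _ (mem_nth 0 (ltn_ord k)).
  by rewrite dot_homog => H; lra.
move=> /= vA; apply/conv_homog_cone/AsP => A /(nthP 0)[k kA <-].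
have := vA (Ordinal kA); rewrite dot_homog rmorphN /=; lra.
Qed.

Theorem rec_integer_hull : S !=set0 -> rec (conv (nat_vecs S)) = cone (nat_vecs
  M).
Proof.
move=> [x0 Sx0]; apply/seteqP; split=> r; last first.
  by move=> Mr v Sv l l0; apply: conv_absorb => //; apply: coneZ.
have [As AsP] := homog_cone_polyhedral => rP.
have : homog_cone r 0.
  apply/AsP => A AAs; rewrite leNgt; apply/negP => A0.
  have Sv : conv (nat_vecs S) (nat_vec R x0).
    rewrite conv_lcomb -[nat_vec R x0]scale1r; apply: lcomb_mem;
      last by exists x0.
    exact: ler01.
  set c := dot (real_vec A) (homog (nat_vec R x0) 1).
  (* The length [l] makes the constraint [A] take the value c + 1 + |c| > 0 at x0 + l r, although
     that point is in the hull. *)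
  set d := dot _ _ in A0; pose l := (1 + `|c|) / d.
  have l0 : 0 <= l by apply: divr_ge0; [exact: addr_ge0 | exact: ltW].
  have /conv_homog_cone/AsP/(_ A AAs) := rP _ Sv _ l0.
  rewrite -[1]addr0 -(mulr0 l) homogD homogZ dotDr dotZr -/c -/d /l divfK
    ?gt_eqF //.
  have := ler_norm (- c); rewrite normrN; lra.
by move=> [w [s [-> /lcomb_nneg0 ->]]]; rewrite add0r.
Qed.

End IntegerHull.

(** * Finite canonical faces *)

Lemma conv_nonempty (R : numFieldType) (V : lmodType R) (S : set V) :
  conv S !=set0 -> S !=set0.
Proof.
move=> [v [[|k] [x [a [Sx _ + _]]]]]; last by exists (x ord0).
by rewrite big_ord0 => /esym/eqP; rewrite oner_eq0.
Qed.

Lemma common_denominator (I : finType) (B : I -> rat) :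
  exists2 N : nat, (0 < N)%N & forall i, N%:R * B i \is a Num.int.
Proof.
exists (\prod_i `|denq (B i)|)%N => [|i].
  by apply: prodn_gt0 => i; rewrite absz_gt0 denq_eq0.
rewrite (bigD1 i) //= mulnC natrM -mulrA rpredM //; first exact: natr_int.
by rewrite natr_absz gtr0_norm ?denq_gt0 // mulrC -numqE intr_int.
Qed.

Lemma ratr_Qint (F : archiNumFieldType) (q : rat) :
  q \is a Num.int -> (ratr q : F) \is a Num.int.
Proof. by move=> /intrP[m ->]; rewrite ratr_int intr_int. Qed.

Section IntegerMatrices.
Context {R : archiNumDomainType} {m n : nat}.
Implicit Types A B : 'M[R]_(m, n).

Lemma mxOver_int0 : (0 : 'M[R]_(m, n)) \is a mxOver Num.int.
Proof. by apply/mxOverP => i j; rewrite mxE rpred0. Qed.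

Lemma mxOver_intD A B : A \is a mxOver Num.int -> B \is a mxOver Num.int ->
  A + B \is a mxOver Num.int.
Proof. by move=> /mxOverP AZ /mxOverP BZ; apply/mxOverP => i j;
  rewrite mxE rpredD. Qed.

Lemma mxOver_intB A B : A \is a mxOver Num.int -> B \is a mxOver Num.int ->
  A - B \is a mxOver Num.int.
Proof. by move=> /mxOverP AZ /mxOverP BZ; apply/mxOverP => i j;
  rewrite !mxE rpredB. Qed.

Lemma mxOver_intZ a A : a \is a Num.int -> A \is a mxOver Num.int ->
  a *: A \is a mxOver Num.int.
Proof. by move=> aZ /mxOverP AZ; apply/mxOverP => i j; rewrite mxE rpredM. Qed.

End IntegerMatrices.

(** * The moment map and the linear space L *)

Section Moment.
Context {R : realType} {n : nat}.
Local Notation fsupp := (@fsupp_space R n).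
Implicit Types (y z : fsupp) (b : 'rV[R]_n) (P : {fset 'rV[R]_n}).

Definition moment y : 'rV[R]_n := \sum_(p <- msupp y) y@_p *: p.

Lemma moment_supset (Q : {fset 'rV[R]_n}) y :
  (msupp y `<=` Q)%fset -> moment y = \sum_(p <- Q) y@_p *: p.
Proof.
move=> yQ; apply: big_fset_incl => // p _ /mcoeff_outdom ->.
by rewrite scale0r.
Qed.

Lemma momentP a y z : moment (a *: y + z) = a *: moment y + moment z.
Proof.
pose Q := (msupp y `|` msupp z)%fset.
rewrite !(@moment_supset Q) ?fsubsetUl ?fsubsetUr //.
  rewrite scaler_sumr -big_split; apply: eq_bigr => p _ /=.
  by rewrite mcoeffD mcoeffZ scalerDl scalerA.
apply/fsubsetP => p; rewrite -mcoeff_neq0 mcoeffD mcoeffZ; apply: contraR.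
rewrite inE negb_or => /andP[/mcoeff_outdom -> /mcoeff_outdom ->].
by rewrite mulr0 addr0.
Qed.

Lemma moment0 : moment 0 = 0.
Proof. by rewrite /moment msupp0 big_seq_fset0. Qed.

Lemma momentZ a y : moment (a *: y) = a *: moment y.
Proof. by rewrite -[a *: y]addr0 momentP moment0 addr0. Qed.

Lemma momentD y z : moment (y + z) = moment y + moment z.
Proof. by rewrite -[y in LHS]scale1r momentP scale1r. Qed.

Lemma moment_sum k (c : 'I_k -> R) (y : 'I_k -> fsupp) :
  moment (\sum_j c j *: y j) = \sum_j c j *: moment (y j).
Proof.
rewrite (big_morph moment momentD moment0).
by apply: eq_bigr => j _; rewrite momentZ.
Qed.

Lemma mcoeff_sum k (c : 'I_k -> R) (y : 'I_k -> fsupp) q :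
  (\sum_j c j *: y j)@_q = \sum_j c j * (y j)@_q.
Proof.
rewrite (big_morph (mcoeff q) (mcoeffD q) (@mcoeff0 _ _ q)).
by apply: eq_bigr => j _; rewrite mcoeffZ.
Qed.

Lemma I_D b y z : I_ b y -> I_ 0 z -> I_ b (y + z).
Proof.
move=> [yN ym] [zN zm]; split=> [p|]; first by rewrite mcoeffD rpredD.
by rewrite -/(moment _) momentD addrAC mxOver_intD // -[moment z]subr0.
Qed.

(** Affine combinations of the hull are affine combinations of [I_ b], and a difference of two of
    them has weight 0. Conversely, r of weight 0 is the difference of r + y0 and y0. *)
Lemma L_lcomb b : I_ b !=set0 -> L_ b = lcomb setT (I_ b) 0.
Proof.
move=> [y0 y0b]; rewrite /L_ /parallel_space aff_lcomb.
apply/seteqP; split=> r.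
  have sub : lcomb setT (conv (I_ b)) 1 `<=` lcomb setT (I_ b) 1.
    move=> x xb; apply: lcomb_lcomb => //; move: xb; apply: lcomb_sub => // {}x.
    by rewrite conv_lcomb; apply: lcomb_sub.
  move=> [x /sub xb [z /sub zb <-]].
  rewrite -(subrr 1) -(mulN1r 1) -scaleN1r; apply: lcombD => //.
  by apply: lcombZ.
move=> rb; have y0b1 : lcomb setT (I_ b) 1 y0.
  by rewrite -[y0]scale1r; apply: lcomb_mem.
have sub : lcomb setT (I_ b) 1 `<=` lcomb setT (conv (I_ b)) 1.
  move=> x; apply: lcomb_sub => // y yb; rewrite conv_lcomb -[y]scale1r;
    apply: lcomb_mem => //.
  exact: ler01.
exists (r + y0); last by exists y0; rewrite ?addrK //; apply: sub.
by apply: sub; rewrite -[1]add0r; apply: lcombD.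
Qed.

End Moment.

(** * Transfer between V_P and R^P, and the recession cone of C^P *)

Section FiniteFace.
Context {R : realType} {n : nat} (b : 'rV[R]_n) (P : {fset 'rV[R]_n}).
Local Notation fsupp := (@fsupp_space R n).
Local Notation drop := (@drop_zeros R n P).
Implicit Types (y z r : fsupp) (x : {ffun P -> R^o}).

Lemma dropP a y z : drop (a *: y + z) = a *: drop y + drop z.
Proof. by apply/ffunP => p; rewrite !ffunE mcoeffD mcoeffZ. Qed.

Lemma drop0 : drop 0 = 0.
Proof. by apply/ffunP => p; rewrite !ffunE mcoeff0. Qed.

Lemma dropZ a y : drop (a *: y) = a *: drop y.
Proof. by rewrite -[a *: y]addr0 dropP drop0 addr0. Qed.

Lemma dropDZ y a z : drop (y + a *: z) = drop y + a *: drop z.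
Proof. by rewrite addrC dropP addrC. Qed.

Lemma drop_inj y z : V_ P y -> V_ P z -> drop y = drop z -> y = z.
Proof.
move=> yP zP /ffunP yz; apply/malgP => p.
have [pP|pP] := boolP (p \in P); last by rewrite yP ?zP.
by have := yz [` pP]%fset; rewrite !ffunE.
Qed.

(** Extension by zero, inverse to [drop] on [V_ P]. The inner default 0 is never reached, since
    [insub] succeeds on [P]. *)
Definition embed x : fsupp :=
  [malg p in P => if insub p is Some q then x q else 0].

Lemma V_embed x : V_ P (embed x).
Proof. by move=> p /negPf pP; rewrite mcoeffE pP. Qed.

Lemma embedK : cancel embed drop.
Proof.
by move=> x; apply/ffunP => p; rewrite ffunE mcoeffE (valP p) valK.
Qed.

Lemma V_lin a y z : V_ P y -> V_ P z -> V_ P (a *: y + z).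
Proof. by move=> yP zP p pP; rewrite mcoeffD mcoeffZ yP ?zP // mulr0 addr0. Qed.

Lemma embedP a x x' : embed (a *: x + x') = a *: embed x + embed x'.
Proof.
apply: drop_inj; rewrite ?dropP ?embedK //; first exact: V_embed.
by apply: V_lin; exact: V_embed.
Qed.

Lemma embed0 : embed 0 = 0.
Proof.
by apply: drop_inj; rewrite ?embedK ?drop0 //; [exact: V_embed|move=> p;
  rewrite mcoeff0].
Qed.

Lemma moment_drop y : V_ P y -> moment y = \sum_(p : P) drop y p *: val p.
Proof.
move=> yP; rewrite (@moment_supset _ _ P); last first.
  by apply/fsubsetP => p; rewrite -mcoeff_neq0; apply: contraR => /yP ->.
by rewrite big_seq_fsetE; apply: eq_bigr => p _; rewrite ffunE.
Qed.

(** The case [c = b] serves as the set S of the integer hull results, and [c = 0] as M. *)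
Definition lattice_points (c : 'rV[R]_n) : set {ffun P -> nat} :=
  [set m | \sum_(p : P) (m p)%:R *: val p - c \is a mxOver Num.int].

Lemma lattice_sumD (m m' : {ffun P -> nat}) :
  \sum_(p : P) ((m + m')%R p)%:R *: val p =
  \sum_(p : P) (m p)%:R *: val p + \sum_(p : P) (m' p)%:R *: val p :> 'rV[R]_n.
Proof. by rewrite -big_split; apply: eq_bigr => p _;
  rewrite ffunE natrD scalerDl. Qed.

Lemma lattice_pointsD c m m' :
  lattice_points c m -> lattice_points 0 m' -> lattice_points c (m + m').
Proof.
rewrite /lattice_points /= lattice_sumD subr0 /= => cm cm'.
by rewrite addrAC mxOver_intD.
Qed.

Lemma lattice_pointsK c m m' :
  lattice_points c m -> lattice_points c (m + m') -> lattice_points 0 m'.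
Proof.
rewrite /lattice_points /= lattice_sumD subr0 addrAC /= => cm /mxOver_intB/(_
  cm).
set A := \sum_(p : P) (m p)%:R *: val p - c.
by rewrite (addrC A) addrK.
Qed.

Lemma I_lattice_points c y : V_ P y ->
  I_ c y <-> nat_vecs (lattice_points c) (drop y).
Proof.
move=> yP; rewrite /I_ /= -/(moment y) moment_drop //; split.
  move=> [yN ym]; exists [ffun p : P => Num.truncn y@_(val p)].
    rewrite /lattice_points /=; congr (is_true (_ - _ \is a _)): ym.
    by apply: eq_bigr => p _; rewrite !ffunE truncnK.
  by apply/ffunP => p; rewrite !ffunE truncnK.
move=> [m mc /ffunP my]; split.
  move=> p; have [pP|pP] := boolP (p \in P); last by rewrite yP.
  by have := my [` pP]%fset; rewrite !ffunE /= => <-.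
congr (is_true (_ - _ \is a _)): mc.
by apply: eq_bigr => p _; rewrite -my !ffunE.
Qed.

Lemma lcomb_I_ge0 c t y : lcomb nneg (I_ c) t y -> fsupp_nonneg y.
Proof.
elim=> [|a s {}t {}y a0 [sN _] _ IH] p; first by rewrite mcoeff0.
by rewrite mcoeffD mcoeffZ addr_ge0 // mulr_ge0 // natr_ge0.
Qed.

Lemma drop_canonical_face :
  drop @` canonical_face b P = conv (nat_vecs (lattice_points b)).
Proof.
rewrite /canonical_face !conv_lcomb; apply/seteqP;
  split=> [_ [y [yb yP] <-]|x xb].
  elim: yb yP => [|a s t {}y a0 sb ys IH] yP; first by rewrite drop0;
    constructor.
  (* A term with coefficient 0 may have support outside [P], so it is dropped; for any other term,
     nonnegativity excludes cancellation outside [P]. *)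
  have [a00|/eqP aN0] := eqVneq a 0.
    by move: yP; rewrite a00 scale0r !add0r.
  have ay0 p : p \notin P -> a * s@_p = 0 /\ y@_p = 0.
    move=> /yP /eqP; rewrite mcoeffD mcoeffZ paddr_eq0.
    - by move=> /andP[/eqP ? /eqP].
    - by apply: mulr_ge0 => //; apply: natr_ge0; case: sb.
    - exact: (lcomb_I_ge0 ys).
  rewrite dropP; constructor => //; last by apply: IH => p /ay0[].
  apply/(I_lattice_points b) => // p /ay0[/eqP + _].
  by rewrite mulf_eq0 => /orP[/eqP|/eqP].
exists (embed x); last exact: embedK.
split; last exact: V_embed.
apply: lcomb_morph xb; [exact: embed0|exact: embedP|move=> s sb].
by apply/I_lattice_points; rewrite ?embedK //; exact: V_embed.
Qed.

(** For s in [I_ 0] and y0 in [I_ b], the sum y0 + s is again in [I_ b], so s = (y0 + s) - y0 has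
    weight 0. *)
Lemma cone_lattice_lcomb y : I_ b !=set0 -> V_ P y ->
  cone (nat_vecs (lattice_points 0)) (drop y) -> lcomb setT (I_ b) 0 y.
Proof.
move=> [y0 y0b] yP yM.
suff : lcomb setT (I_ b) 0 (embed (drop y)).
  by congr lcomb; apply: drop_inj; rewrite ?embedK //; exact: V_embed.
move: {yP} (drop y) yM; apply: cone_ind => [|a s v _ sM _ IH].
  by rewrite embed0; constructor.
rewrite embedP -[0]addr0; apply: lcombD => //.
rewrite -(mulr0 a); apply: lcombZ => //.
have sI : I_ 0 (embed s).
  by apply/I_lattice_points; rewrite ?embedK //; exact: V_embed.
rewrite -(subrr 1) -[embed s](addrK y0) -(scaleN1r y0).
apply: lcombD; last by apply: lcomb_mem.
by rewrite -[_ + y0]scale1r; apply: lcomb_mem => //; rewrite addrC; apply: I_D.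
Qed.

(* The coefficient vectors g with sum 0 for which \sum_j g j *: y j is
   nonnegative and supported on P form a rational polyhedral cone. Its
   generators are rational, and suitable multiples of them yield points of
   lattice_points 0. *)
Lemma lcomb_cone_lattice r : lcomb setT (I_ b) 0 r -> fsupp_nonneg r ->
  V_ P r -> cone (nat_vecs (lattice_points 0)) (drop r).
Proof.
move=> /lcombP[k [y [c [yb _ c0 ->]]]].
have [T TD] : exists T : {ffun 'I_k -> R^o} -> fsupp,
    forall g, T g = \sum_j (g j : R) *: y j by eexists.
pose row q : {ffun 'I_k -> rat} := [ffun j => (Num.truncn (y j)@_q)%:R].
have TE g q : (T g)@_q = dot (real_vec (row q)) g.
  rewrite TD mcoeff_sum; apply: eq_bigr => j _.
  by rewrite !ffunE ratr_nat truncnK 1?mulrC //; case: (yb j).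
have TP a g h : T (a *: g + h) = a *: T g + T h.
  by apply/malgP => q; rewrite mcoeffD mcoeffZ !TE dotDr dotZr.
have dotN A g : dot (real_vec (- A)) g = - dot (real_vec A) g.
  by rewrite /dot -sumrN; apply: eq_bigr => j _; rewrite !ffunE rmorphN mulNr.
(* Outside [Q] every [T g] vanishes, so finitely many sign and support constraints suffice. *)
pose Q := flatten [seq (msupp (y j) : seq _) | j <- enum 'I_k].
have TQ g q : q \notin Q -> (T g)@_q = 0.
  move=> qQ; rewrite TD mcoeff_sum big1 // => j _;
    rewrite mcoeff_outdom ?mulr0 //.
  by apply: contra qQ => qj; apply/flatten_mapP; exists j; rewrite ?mem_enum.
pose one : {ffun 'I_k -> rat} := [ffun=> 1].
have oneE g : dot (real_vec one) g = \sum_j g j.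
  by apply: eq_bigr => j _; rewrite !ffunE rmorph1 mul1r.
(* In order: the coefficients sum to 0 (two inequalities), [T g] is nonnegative on [Q], and [T g] is
   at most 0 on [Q] outside [P], where it therefore vanishes. *)
pose As := [:: one; - one] ++ [seq - row q | q <- Q] ++
           [seq row q | q <- Q & q \notin P].
have AsP g : halfspaces As g <->
    [/\ \sum_j (g j : R) = 0, fsupp_nonneg (T g) & V_ P (T g)].
  split=> [gA|[g0 Tg0 TgP] A].
    have Tg0 : fsupp_nonneg (T g).
      move=> q; have [qQ|/TQ ->//] := boolP (q \in Q).
      rewrite TE -oppr_le0 -dotN; apply: gA.
      by rewrite !mem_cat (map_f (fun q => - row q)) ?orbT.
    split=> // [|q qP].
      apply/eqP; rewrite eq_le -oneE -[0 <= _]oppr_le0 -dotN.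
      by rewrite !gA // mem_cat !inE eqxx ?orbT.
    have [qQ|/TQ ->//] := boolP (q \in Q).
    apply/eqP; rewrite eq_le Tg0 andbT TE; apply: gA.
    by rewrite !mem_cat (map_f row) ?orbT // mem_filter qP.
  rewrite !mem_cat !inE -orbA => /or4P[/eqP ->|/eqP ->|/mapP[q _ ->]|/mapP[q +
    ->]].
  - by rewrite oneE g0.
  - by rewrite dotN oneE g0 oppr0.
  - by rewrite dotN -TE oppr_le0.
  - by rewrite mem_filter -TE => /andP[/TgP ->].
have [Bs BsP] := @minkowski R _ As.
pose g0 : {ffun 'I_k -> R^o} := [ffun j => c j].
have -> : \sum_j c j *: y j = T g0 by rewrite TD; apply: eq_bigr => j _;
  rewrite ffunE.
move=> r0 rP; have : cone (real_vecs Bs) g0.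
  by rewrite -BsP; apply/AsP; split=> //; rewrite -[RHS]c0;
    apply: eq_bigr => j _; rewrite ffunE.
have T0 : T 0 = 0 by rewrite TD big1 // => j _; rewrite ffunE scale0r.
move: {r0 rP} g0; apply: cone_ind => [|a _ g a0 [B BBs <-] _ IH].
  by rewrite T0 drop0; exact: cone0.
rewrite TP dropP; apply: coneD => //; apply: coneZ => //.
have /AsP[B0 TB0 TBP] : halfspaces As (real_vec B : {ffun 'I_k -> R^o}).
  by rewrite BsP; apply: cone_mem; exists B.
have [N N0 NB] := common_denominator B.
have N0R : (N%:R : R) != 0 by rewrite pnatr_eq0 -lt0n.
have NBR j : N%:R * (real_vec B j : R) \is a Num.int.
  by rewrite ffunE -[N%:R](ratr_nat R) -rmorphM ratr_Qint.
(* Clearing denominators makes [z] an integer combination of the [y j]; being nonnegative, it has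
   natural values. *)
pose z := N%:R *: T (real_vec B).
have zP : V_ P z by move=> q qP; rewrite mcoeffZ TBP ?mulr0.
have zE : z = \sum_j (N%:R * (real_vec B j : R)) *: y j.
  by rewrite /z TD scaler_sumr; apply: eq_bigr => j _; rewrite scalerA.
suff zI : I_ 0 z.
  have -> : T (real_vec B) = N%:R^-1 *: z by rewrite scalerA mulVf // scale1r.
  rewrite dropZ; apply: coneZ_mem; first by rewrite invr_ge0 ler0n.
  exact/I_lattice_points.
split=> [q|].
  rewrite natrEint mcoeffZ mulr_ge0 ?ler0n // andbT -mcoeffZ -/z zE mcoeff_sum.
  apply: rpred_sum => j _; rewrite rpredM //.
  by apply: intr_nat; case: (yb j).
rewrite -/(moment z) subr0 zE moment_sum.
(* Because the coefficients sum to 0, [b] may be subtracted from every moment, and each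
   [moment (y j) - b] is integral. *)
have -> : \sum_j (N%:R * (real_vec B j : R)) *: moment (y j) =
    \sum_j (N%:R * (real_vec B j : R)) *: (moment (y j) - b).
  under [RHS]eq_bigr do rewrite scalerBr.
  by rewrite sumrB -scaler_suml -mulr_sumr B0 mulr0 scale0r subr0.
apply: (big_ind (fun A => A \is a mxOver Num.int)) => [||j _];
  [exact: mxOver_int0|exact: mxOver_intD|].
by apply: mxOver_intZ (NBR j) _; case: (yb j).
Qed.

Lemma drop_L_nonneg : I_ b !=set0 ->
  drop @` (L_ b `&` fsupp_nonneg `&` V_ P) = cone (nat_vecs (lattice_points 0)).
Proof.
move=> Ib; rewrite (L_lcomb Ib); apply/seteqP; split.
  by move=> _ [r [[rb r0] rP] <-]; exact: lcomb_cone_lattice.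
move=> x xM; exists (embed x); last exact: embedK.
split; last exact: V_embed.
split; first by apply: cone_lattice_lcomb; rewrite ?embedK //; exact: V_embed.
have x0 : nonneg_orthant x.
  move: x xM; apply: cone_ind => [p|a _ v a0 [m _ <-] _ v0 p];
    first by rewrite ffunE.
  by rewrite !ffunE addr_ge0 // mulr_ge0 // ffunE ler0n.
move=> p; rewrite mcoeffE; case: ifP => // pP.
by rewrite insubT; exact: x0.
Qed.

Lemma drop_nonneg : drop @` (L_ b `&` fsupp_nonneg `&` V_ P) =
  (drop @` (L_ b `&` V_ P)) `&` nonneg_orthant.
Proof.
apply/seteqP; split=> [_ [r [[rb r0] rP] <-]|x [[r [rb rP] <-] r0]].
  by split; [exists r | move=> p; rewrite ffunE].
exists r => //; split=> //; split=> // p.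
have [pP|/rP ->//] := boolP (p \in P).
by have := r0 [` pP]%fset; rewrite ffunE.
Qed.

(** A point y0 of the face forces r into [V_ P], as y0 and y0 + r both vanish outside [P]; on [V_ P]
    the map [drop] is injective, so membership can be tested after dropping zeros. *)
Lemma rec_canonical_face r : canonical_face b P !=set0 ->
  rec (canonical_face b P) r <->
  V_ P r /\ rec (drop @` canonical_face b P) (drop r).
Proof.
move=> [y0 y0C]; split.
  move=> rC; split=> [p pP|_ [y yC <-] l l0].
    have [_ /(_ p pP)] := rC y0 y0C 1 ler01.
    by case: y0C => _ /(_ p pP) y0p; rewrite scale1r mcoeffD y0p add0r.
  by exists (y + l *: r); [exact: rC | exact: dropDZ].
move=> [rP rC] y yC l l0; have [|z zC] := rC (drop y) _ l l0; first by exists y.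
rewrite -dropDZ => zE; suff <- : z = y + l *: r by [].
by apply: drop_inj zE; [case: zC|rewrite addrC; apply: V_lin => //; case: yC].
Qed.

End FiniteFace.

Theorem theorem4p2 (R : realType) (n : nat) (b : 'rV[R]_n)
    (b_notin_Zn : b \isn't a mxOver Num.int) (P : {fset 'rV[R]_n}) :
  [/\ rational_polyhedron (@drop_zeros R n P @` canonical_face b P),
      forall E : set {ffun P -> R^o},
        extreme_ray (@drop_zeros R n P @` canonical_face b P) E ->
        exists d : {ffun P -> R^o},
          [/\ forall p, (d p : R) \is a Num.nat,
              \sum_(p : P) (d p : R) *: val p \is a mxOver Num.int
            & E = half_line d]
    & canonical_face b P !=set0 ->
      [/\ rec (canonical_face b P) = L_ b `&` fsupp_nonneg `&` V_ P,
          rec (@drop_zeros R n P @` canonical_face b P) =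
            @drop_zeros R n P @` (L_ b `&` fsupp_nonneg `&` V_ P)
        & @drop_zeros R n P @` (L_ b `&` fsupp_nonneg `&` V_ P) =
            (@drop_zeros R n P @` (L_ b `&` V_ P)) `&` nonneg_orthant]].
Proof.
have faceE := drop_canonical_face b P.
have recE : @lattice_points R n P b !=set0 ->
    rec (conv (nat_vecs (R := R) (@lattice_points R n P b))) =
    cone (nat_vecs (@lattice_points R n P 0)).
  by apply: rec_integer_hull;
    [exact: lattice_pointsD|exact: lattice_pointsK|exact: lattice_pointsK].
split.
- rewrite faceE; apply: integer_hull_polyhedral;
    [exact: lattice_pointsD|exact: lattice_pointsK|exact: lattice_pointsK].
- move=> E; rewrite faceE => rayE.
  (* The existence of an extreme ray makes the face nonempty, so the formula for its recession cone
     is available. *)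
  have [_ [m0 m0b _]] := conv_nonempty (extreme_ray_nonempty rayE).
  have [_ [m mM <-] ->] := extreme_ray_cone (recE (ex_intro _ _ m0b)) rayE.
  exists (nat_vec R m); split=> // [p|]; first by rewrite ffunE natr_nat.
  move: mM; rewrite /lattice_points /= subr0; congr (is_true (_ \is a _)).
  by apply: eq_bigr => p _; rewrite ffunE.
move=> C0; have Ib : I_ b !=set0.
  by apply: conv_nonempty; case: C0 => y [yb _]; exists y.
have recD : rec (@drop_zeros R n P @` canonical_face b P) =
    @drop_zeros R n P @` (L_ b `&` fsupp_nonneg `&` V_ P).
  rewrite (drop_L_nonneg P Ib) faceE recE //.
  have [|_ [m mb _]] := @conv_nonempty R _ (nat_vecs (@lattice_points R n P b)).
    by rewrite -faceE; case: C0 => y yC; exists (drop_zeros P y); exists y.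
  by exists m.
split=> //; last exact: drop_nonneg.
apply/seteqP; split=> r.
  move=> /(rec_canonical_face _ C0)[rP]; rewrite recD => -[z zL zr].
  by rewrite -(drop_inj _ rP zr) //; case: zL.
move=> rL; apply/(rec_canonical_face _ C0); split; first by case: rL.
by rewrite recD; exists r.
Qed.
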